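(* Let $u\ge1$, $n=4u-1$, $r_1=2u-1$, $r_2=2u$, and let $(Y,w)$ be a weighted subset of the union of the two shells $X_{r_1}\cup X_{r_2}$ in $H(n,2)$ with $w\equiv1$. Let $\mathcal B_{r_\nu}=\{B_y: y\in Y\cap X_{r_\nu}\}$ for $\nu=1,2$. Then $(Y,w)$ is a tight relative $3$-design if and only if $(V,\mathcal B_{r_1})$ is a symmetric $2$-$(4u-1,2u-1,u-1)$ design and $(V,\mathcal B_{r_2})$ is the complementary design of $(V,\mathcal B_{r_1})$, i.e. $\mathcal B_{r_2}=\{V\setminus B: B\in\mathcal B_{r_1}\}$.
   Context: Let $V=\{1,\dots,n\}$, let $X=\{0,1\}^n$ be the point set of the binary Hamming scheme $H(n,2)$, $u_0=(0,\dots,0)$, and let the shell $X_r$ be the set of vectors in $X$ with exactly $r$ ones. For $x\in X$ put $B_x=\{i\in V: x_i=1\}$. If $Y\subset X_{r_1}\cup X_{r_2}$ with $r_1\neq r_2$ and $w:Y\to\mathbb R_{>0}$, put $Y_{r_\nu}=Y\cap X_{r_\nu}$ and $w(Y_{r_\nu})=\sum_{y\in Y_{r_\nu}}w(y)$; then $(Y,w)$ is a relative $t$-design with respect to $u_0$ if for every $1\le j\le t$ and every $z\in X_j$ $$\sum_{\nu=1}^2\frac{w(Y_{r_\nu})}{|X_{r_\nu}|}\sum_{x\in X_{r_\nu}}f_z(x)=\sum_{y\in Y}w(y)f_z(y),$$ where $f_z(x)=1$ if $B_z\subset B_x$ and $f_z(x)=0$ otherwise. (For $H(n,2)$ this P-structure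 definition coincides with the Q-structure one.) A relative $(2e+1)$-design $(Y,w)$ on two shells $X_{r_1}\cup X_{r_2}$ (both $Y_{r_1},Y_{r_2}$ nonempty) with $w$ constant on each $Y_{r_\nu}$ is called tight if $|Y|=2\binom ne$; thus for $3$-designs tight means $|Y|=2n$. A $2$-$(n,k,\lambda)$ design is a set of $k$-element subsets (blocks) of an $n$-set such that any two distinct points lie in exactly $\lambda$ common blocks; it is symmetric if the number of blocks is $n$. *)

(* Defs.v *)
From HB Require Import structures.
From mathcomp Require Import all_boot all_order all_algebra.
From mathcomp Require Import reals.
Set Implicit Arguments.
Unset Strict Implicit.
Unset Printing Implicit Defensive.
Import Order.TTheory GRing.Theory Num.Theory.
Local Open Scope ring_scope.

(* The ground set V = {1, ..., n} is represented by 'I_n = {0, ..., n-1}. *)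
Notation point n := {ffun 'I_n -> bool}.

Definition supp (n : nat) (x : point n) : {set 'I_n} := [set i | x i].

Definition shell (n r : nat) : {set point n} := [set x | #|supp x| == r].

Definition supp_ind (R : realType) (n : nat) (z x : point n) : R :=
  (supp z \subset supp x)%:R.

Definition shell_part (n r : nat) (Y : {set point n}) : {set point n} :=
  Y :&: shell n r.

Definition weight (R : realType) (n : nat) (w : point n -> R)
  (A : {set point n}) : R := \sum_(y in A) w y.

Definition shell_term (R : realType) (n : nat) (Y : {set point n})
    (w : point n -> R) (z : point n) (r : nat) : R :=
  weight w (shell_part r Y) / #|shell n r|%:R
  * \sum_(x in shell n r) supp_ind R z x.

(* Weights are total functions on X; only their values on Y matter. *)
Definition relative_design (R : realType) (n t r1 r2 : nat)
    (Y : {set point n}) (w : point n -> R) : Prop :=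
  [/\ r1 <> r2,
      Y \subset shell n r1 :|: shell n r2,
      forall y, y \in Y -> 0 < w y
    & forall (j : nat) (z : point n),
        (1 <= j <= t)%N -> z \in shell n j ->
        shell_term Y w z r1 + shell_term Y w z r2
        = \sum_(y in Y) w y * supp_ind R z y].

Definition constant_on (R : realType) (n : nat) (w : point n -> R)
  (A : {set point n}) : Prop := {in A &, forall x y, w x = w y}.

Definition tight_relative_design (R : realType) (n e r1 r2 : nat)
    (Y : {set point n}) (w : point n -> R) : Prop :=
  [/\ relative_design (2 * e + 1) r1 r2 Y w,
      shell_part r1 Y != set0 /\ shell_part r2 Y != set0,
      constant_on w (shell_part r1 Y) /\ constant_on w (shell_part r2 Y)
    & #|Y| = (2 * 'C(n, e))%N].

Definition blocks (n r : nat) (Y : {set point n}) : {set {set 'I_n}} :=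
  [set supp y | y in shell_part r Y].

Definition two_design (n k lambda : nat) (B : {set {set 'I_n}}) : Prop :=
  (forall b, b \in B -> #|b| = k) /\
  (forall p q : 'I_n, p != q ->
     #|[set b in B | (p \in b) && (q \in b)]| = lambda).

Definition symmetric_two_design (n k lambda : nat) (B : {set {set 'I_n}}) :
  Prop := two_design k lambda B /\ #|B| = n.

Definition complementary (n : nat) (B : {set {set 'I_n}}) :
  {set {set 'I_n}} := [set ~: b | b in B].

(* Main.v *)
(** Each block set [B_i] of a relative 3-design on two shells is a 2-design:
    summing the condition on triples and pairs over the last point gives linear
    systems that separate the shells.  For blocks of size [k] and a fixed block
    [A], put [c = k (k - 1) / (n - 1)]; the sum of [(#|A :&: b| - c) ^+ 2] over
    the blocks [b != A] is a positive multiple of [rho - k], [rho] being the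
    replication number.  This gives Fisher's inequality, with constant
    intersection size [c] in case of equality, so tightness forces both block
    sets to be symmetric.  For [x] in the first one, the first three moments
    of [m = #|x :&: y|], with [y] in the second one, yield
    [\sum m * (m - u) ^+ 2 = 0]; hence [m] is [0] or [u], and not always [u],
    so some [y] is the complement of [x].  Conversely, inclusion-exclusion shows
    that a symmetric 2-design and its complement together cover every triple
    equally often. *)
Require Import Defs.
From HB Require Import structures.
From mathcomp Require Import all_boot all_order all_algebra.
From mathcomp Require Import reals.
From mathcomp Require Import ring lra zify.
Set Implicit Arguments.
Unset Strict Implicit.
Unset Printing Implicit Defensive.
Import Order.TTheory GRing.Theory Num.Theory.
Local Open Scope ring_scope.

(** * Incidence functions and degrees of points, pairs and triples *)

Definition inc (R : realFieldType) (T : finType) (b : {set T}) (p : T) : R :=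
  (p \in b)%:R.

Definition deg1 (R : realFieldType) (T : finType) (B : {set {set T}}) p : R :=
  \sum_(b in B) inc R b p.

Definition deg2 (R : realFieldType) (T : finType) (B : {set {set T}}) p q : R :=
  \sum_(b in B) inc R b p * inc R b q.

(** The three points may coincide, because the moment expansions run over all triples; the lemmas
    [deg3xx], [deg3xyx] and [deg3xyy] reduce repeated points. *)
Definition deg3 (R : realFieldType) (T : finType) (B : {set {set T}}) p q s
  : R :=
  \sum_(b in B) inc R b p * inc R b q * inc R b s.

Lemma sum_inc (R : realFieldType) (T : finType) (A b : {set T}) :
  \sum_(p in A) inc R b p = #|A :&: b|%:R.
Proof.
rewrite -sum1_card natr_sum big_mkcond [RHS]big_mkcond /=.
by apply: eq_bigr => p _; rewrite inE /inc; case: (p \in A); case: (p \in b).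
Qed.

Lemma incM (R : realFieldType) (T : finType) (b : {set T}) p :
  inc R b p * inc R b p = inc R b p.
Proof. by rewrite /inc -natrM mulnb andbb. Qed.

Lemma incC (R : realFieldType) (T : finType) (b : {set T}) p :
  inc R (~: b) p = 1 - inc R b p.
Proof. by rewrite /inc inE; case: (p \in b); rewrite ?subrr ?subr0. Qed.

Lemma deg2xx (R : realFieldType) (T : finType) (B : {set {set T}}) p :
  deg2 R B p p = deg1 R B p.
Proof. by apply: eq_bigr => b _; rewrite incM. Qed.

Lemma deg2C (R : realFieldType) (T : finType) (B : {set {set T}}) p q :
  deg2 R B p q = deg2 R B q p.
Proof. by apply: eq_bigr => b _; rewrite mulrC. Qed.

Lemma deg3_rot (R : realFieldType) (T : finType) (B : {set {set T}}) p q s :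
  deg3 R B p q s = deg3 R B q s p.
Proof. by apply: eq_bigr => b _; ring. Qed.

Lemma deg3xx (R : realFieldType) (T : finType) (B : {set {set T}}) p s :
  deg3 R B p p s = deg2 R B p s.
Proof. by apply: eq_bigr => b _; rewrite incM. Qed.

Lemma deg3xyx (R : realFieldType) (T : finType) (B : {set {set T}}) p q :
  deg3 R B p q p = deg2 R B p q.
Proof. by rewrite -deg3_rot deg3xx. Qed.

Lemma deg3xyy (R : realFieldType) (T : finType) (B : {set {set T}}) p q :
  deg3 R B p q q = deg2 R B p q.
Proof. by rewrite deg3_rot deg3xx deg2C. Qed.

(** * Moments of the intersection sizes with a fixed set *)

Section Moments.
Context (R : realFieldType) (T : finType).
Implicit Types (A : {set T}) (B : {set {set T}}).

Lemma moment1E A B :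
  \sum_(b in B) #|A :&: b|%:R = \sum_(p in A) deg1 R B p.
Proof. by rewrite exchange_big; apply: eq_bigr => b _; rewrite sum_inc. Qed.

(** A power of [#|A :&: b|] counts tuples of points of [A] lying in [b]; exchanging the sums turns
    this into degrees. *)
Lemma moment2E A B :
  \sum_(b in B) #|A :&: b|%:R ^+ 2
  = \sum_(p in A) \sum_(q in A) deg2 R B p q.
Proof.
under [RHS]eq_bigr => p _ do rewrite exchange_big.
rewrite exchange_big; apply: eq_bigr => b _.
by rewrite -sum_inc expr2 big_distrlr.
Qed.

Lemma moment3E A B :
  \sum_(b in B) #|A :&: b|%:R ^+ 3
  = \sum_(p in A) \sum_(q in A) \sum_(s in A) deg3 R B p q s.
Proof.
under [RHS]eq_bigr => p _.
  under eq_bigr => q _ do rewrite exchange_big.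
  rewrite exchange_big; over.
rewrite exchange_big; apply: eq_bigr => b _.
rewrite -sum_inc exprS expr2 big_distrlr big_distrlr /=.
apply: eq_bigr => p _; apply: eq_bigr => q _.
by rewrite big_distrr; apply: eq_bigr => s _ /=; rewrite mulrA.
Qed.

Lemma sum_const A (c : R) : \sum_(p in A) c = c * #|A|%:R.
Proof. by rewrite sumr_const mulr_natr. Qed.

Lemma sum_pred1 A p (c : R) :
  \sum_(q in A) (p == q)%:R * c = (p \in A)%:R * c.
Proof.
rewrite -mulr_suml; congr (_ * _).
rewrite (eq_bigr (fun q => inc R [set p] q)) => [|q _]; last first.
  by rewrite /inc inE eq_sym.
rewrite sum_inc; case: (boolP (p \in A)) => pA.
  by rewrite (setIidPr _) ?sub1set ?cards1.
rewrite (_ : A :&: _ = set0) ?cards0 //; apply/setP => q.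
by rewrite !inE; case: eqVneq => [->|]; rewrite ?andbF ?(negbTE pA).
Qed.

Lemma moment1 A B (rho : R) : (forall p, deg1 R B p = rho) ->
  \sum_(b in B) #|A :&: b|%:R = rho * #|A|%:R.
Proof.
by move=> h; rewrite moment1E (eq_bigr _ (fun p _ => h p)) sumr_const mulr_natr.
Qed.

Lemma moment2 A B (rho lam : R) : (forall p, deg1 R B p = rho) ->
  (forall p q, p != q -> deg2 R B p q = lam) ->
  \sum_(b in B) #|A :&: b|%:R ^+ 2
  = lam * #|A|%:R ^+ 2 + (rho - lam) * #|A|%:R.
Proof.
move=> h1 h2; have E p q : deg2 R B p q = lam + (p == q)%:R * (rho - lam).
  case: eqVneq => [<-|/h2->]; last by rewrite mul0r addr0.
  by rewrite deg2xx h1 /=; ring.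
rewrite moment2E.
rewrite (eq_bigr (fun p => lam * #|A|%:R + (rho - lam))) => [|p pA].
  by rewrite sum_const; ring.
rewrite (eq_bigr _ (fun q _ => E p q)) big_split /=.
by rewrite sum_const sum_pred1 pA mul1r.
Qed.

Lemma moment3 A B (rho lam mu : R) : (forall p, deg1 R B p = rho) ->
  (forall p q, p != q -> deg2 R B p q = lam) ->
  (forall p q s, p != q -> q != s -> p != s -> deg3 R B p q s = mu) ->
  \sum_(b in B) #|A :&: b|%:R ^+ 3
  = mu * #|A|%:R ^+ 3 + 3 * (lam - mu) * #|A|%:R ^+ 2
    + (rho - 3 * lam + 2 * mu) * #|A|%:R.
Proof.
move=> h1 h2 h3.
(* Splitting by coincidence pattern: each equality of two points raises [mu] to [lam]. If all three
   agree, the last term corrects [mu + 3 (lam - mu)] to [rho]. *)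
have E p q s : deg3 R B p q s = mu + (p == q)%:R * (lam - mu)
    + (q == s)%:R * (lam - mu) + (p == s)%:R * (lam - mu)
    + (p == q)%:R * ((p == s)%:R * (rho - 3 * lam + 2 * mu)).
  case: (eqVneq p q) => [<-|pq].
    rewrite deg3xx; case: eqVneq => [<-|/h2->]; last by move=> /=; ring.
    by rewrite deg2xx h1 /=; ring.
  case: (eqVneq q s) => [<-|qs].
    by rewrite deg3xyy h2 // (negbTE pq) /=; ring.
  case: (eqVneq p s) => [<-|ps]; last by rewrite h3 //=; ring.
  by rewrite deg3xyx h2 //=; ring.
rewrite moment3E.
rewrite (eq_bigr (fun p => mu * #|A|%:R ^+ 2 + 3 * (lam - mu) * #|A|%:R
   + (rho - 3 * lam + 2 * mu))) => [|p pA].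
  by rewrite sum_const; ring.
rewrite (eq_bigr (fun q => (mu * #|A|%:R + 2 * (lam - mu))
   + (p == q)%:R * ((lam - mu) * #|A|%:R + (rho - 3 * lam + 2 * mu)))).
  by rewrite big_split /= sum_const sum_pred1 pA /=; ring.
move=> q qA; rewrite (eq_bigr _ (fun s _ => E p q s)) !big_split /=.
rewrite -!mulr_sumr !sum_pred1 pA qA !sum_const /=.
by ring.
Qed.
End Moments.

(** * Double counting and separation of the two shells *)

Lemma sum_incT (R : realFieldType) (T : finType) (b : {set T}) :
  \sum_p inc R b p = #|b|%:R.
Proof.
by rewrite -[b in RHS]setTI -sum_inc; apply: eq_bigl => p; rewrite inE.
Qed.

Lemma sum_deg2 (R : realFieldType) (T : finType) (B : {set {set T}}) r p :
  (forall b, b \in B -> #|b| = r) ->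
  \sum_q deg2 R B p q = r%:R * deg1 R B p.
Proof.
move=> hB; rewrite exchange_big mulr_sumr; apply: eq_bigr => b /hB <-.
by rewrite -mulr_sumr sum_incT mulrC.
Qed.

Lemma sum_deg3 (R : realFieldType) (T : finType) (B : {set {set T}}) r p q :
  (forall b, b \in B -> #|b| = r) ->
  \sum_s deg3 R B p q s = r%:R * deg2 R B p q.
Proof.
move=> hB; rewrite exchange_big mulr_sumr; apply: eq_bigr => b /hB <-.
by rewrite -mulr_sumr sum_incT mulrC.
Qed.

Lemma two_unknowns (R : realFieldType) (s t a b a' b' : R) : s != t ->
  a + b = a' + b' -> s * a + t * b = s * a' + t * b' -> a = a'.
Proof.
move=> st h1 h2; have /eqP : (s - t) * (a - a') = 0.
  have {h1} hb : b = a' + b' - a by lra.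
  by move: h2; rewrite hb => h2; nra.
by rewrite mulf_eq0 subr_eq0 (negbTE st) /= subr_eq0 => /eqP.
Qed.

(** The unknowns [deg1 R B1 p] and [deg1 R B2 p] have a known sum. Summing the pair equation over
    the second point gives another equation, with coefficients [r1] and [r2]. As [r1 != r2], the
    system has one solution, and [e1], [e2] say that [rho1], [rho2] solve it. Triples determine the
    pair degrees in the same way through [f1], [f2]. *)
Lemma deg_split (R : realFieldType) (T : finType) (B1 B2 : {set {set T}})
    (r1 r2 : nat) (rho1 rho2 lam1 lam2 mu1 mu2 : R) : r1 != r2 ->
  (forall b, b \in B1 -> #|b| = r1) -> (forall b, b \in B2 -> #|b| = r2) ->
  rho1 * (r1%:R - 1) = lam1 * (#|T|%:R - 1) ->
  rho2 * (r2%:R - 1) = lam2 * (#|T|%:R - 1) ->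
  lam1 * (r1%:R - 2) = mu1 * (#|T|%:R - 2) ->
  lam2 * (r2%:R - 2) = mu2 * (#|T|%:R - 2) ->
  (forall p, deg1 R B1 p + deg1 R B2 p = rho1 + rho2) ->
  (forall p q, p != q -> deg2 R B1 p q + deg2 R B2 p q = lam1 + lam2) ->
  (forall p q s, p != q -> q != s -> p != s ->
     deg3 R B1 p q s + deg3 R B2 p q s = mu1 + mu2) ->
  (forall p, deg1 R B1 p = rho1) /\
  (forall p q, p != q -> deg2 R B1 p q = lam1).
Proof.
move=> r12 s1 s2 e1 e2 f1 f2 h1 h2 h3; have r12R : r1%:R != r2%:R :> R.
  by rewrite eqr_nat.
have sumT (F : T -> R) : \sum_q F q = \sum_(q in [set: T]) F q.
  by apply: eq_bigl => q; rewrite inE.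
split=> [p|p q pq]; apply: (two_unknowns r12R); [exact: h1| |exact: h2|].
  rewrite -!sum_deg2 // -big_split /=.
  rewrite (eq_bigr (fun q => (lam1 + lam2)
      + (p == q)%:R * (rho1 + rho2 - (lam1 + lam2)))) => [|q _].
    by rewrite sumT big_split /= sum_const sum_pred1 cardsT inE /=; lra.
  by case: eqVneq => [<-|/h2->]; rewrite /= ?deg2xx ?h1; ring.
rewrite -!sum_deg3 // -big_split /=.
rewrite (eq_bigr (fun s => (mu1 + mu2)
    + (p == s)%:R * (lam1 + lam2 - (mu1 + mu2))
    + (q == s)%:R * (lam1 + lam2 - (mu1 + mu2)))) => [|s _].
  by rewrite sumT !big_split /= !sum_const !sum_pred1 cardsT !inE /=; lra.
case: (eqVneq p s) => [<-|ps]; rewrite /= ?[q == p]eq_sym.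
  by rewrite (negbTE pq) !deg3xyx h2 //=; ring.
case: (eqVneq q s) => [<-|qs] /=; last by rewrite h3 //; ring.
by rewrite !deg3xyy h2 //; ring.
Qed.

(** * Fisher's inequality and its equality case *)

Section Fisher.
Context (R : realFieldType) (T : finType) (B : {set {set T}}) (k : nat).
Context (rho lam : R).
Context (sizeB : forall b, b \in B -> #|b| = k).
Context (n1 : (1 < #|T|)%N).
Context (cardB : #|B|%:R * k%:R = #|T|%:R * rho).
Context (rho_lam : rho * (k%:R - 1) = lam * (#|T|%:R - 1)).
Context (h1 : forall p, deg1 R B p = rho).
Context (h2 : forall p q, p != q -> deg2 R B p q = lam).

Implicit Types (A : {set T}).

(** This centre equals [lam] when [rho = k]. With [s = (n - k) / (n - 1)] and [n = #|T|], the
    squared deviations from it sum to [rho k s^2] over all blocks, while the block [A] itself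
    contributes [k^2 s^2]. *)
Let c : R := k%:R * (k%:R - 1) / (#|T|%:R - 1).

Lemma sum_meet_sqr A : (0 < k)%N -> #|A| = k ->
  \sum_(b in B) (#|A :&: b|%:R - c) ^+ 2
  = rho * k%:R * ((#|T|%:R - k%:R) / (#|T|%:R - 1)) ^+ 2.
Proof.
move=> k0 cA.
have n1R : #|T|%:R - 1 != 0 :> R by rewrite subr_eq0 (eqr_nat R _ 1) gtn_eqF.
have kR : k%:R != 0 :> R by rewrite pnatr_eq0 -lt0n.
rewrite (eq_bigr (fun b => #|A :&: b|%:R ^+ 2 + (- (2 * c)) * #|A :&: b|%:R
  + c ^+ 2)) => [|b _]; last by ring.
rewrite !big_split /= -mulr_sumr (moment1 _ h1) (moment2 _ h1 h2) cA sum_const.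
(* Flag counting and pair counting eliminate [#|B|] and [lam], leaving an identity in [n], [k] and
   [rho]. *)
have -> : #|B|%:R = #|T|%:R * rho / k%:R :> R by rewrite -cardB mulfK.
have -> : lam = rho * (k%:R - 1) / (#|T|%:R - 1) by rewrite rho_lam mulfK.
by rewrite /c; field; rewrite n1R kR.
Qed.

Lemma meet_self : (k%:R - c) ^+ 2
  = k%:R * k%:R * ((#|T|%:R - k%:R) / (#|T|%:R - 1)) ^+ 2.
Proof.
have n1R : #|T|%:R - 1 != 0 :> R by rewrite subr_eq0 (eqr_nat R _ 1) gtn_eqF.
by rewrite /c; field.
Qed.

Lemma sum_meet_others A : (0 < k)%N -> A \in B ->
  \sum_(b in B | b != A) (#|A :&: b|%:R - c) ^+ 2
  = (rho - k%:R) * k%:R * ((#|T|%:R - k%:R) / (#|T|%:R - 1)) ^+ 2.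
Proof.
move=> k0 AB; have := sum_meet_sqr k0 (sizeB AB).
rewrite (bigD1 A) //= setIid sizeB // meet_self => /(canRL (addKr _))->; ring.
Qed.

(** A sum of squares is nonnegative, and [k < #|T|] makes the factor multiplying [rho - k] strictly
    positive. *)
Lemma fisher : (0 < k < #|T|)%N -> B != set0 -> k%:R <= rho.
Proof.
move=> /andP[k0 kn] /set0Pn[A AB].
have : 0 <= \sum_(b in B | b != A) (#|A :&: b|%:R - c) ^+ 2.
  by apply: sumr_ge0 => b _; exact: sqr_ge0.
rewrite sum_meet_others // -mulrA pmulr_lge0 ?subr_ge0 //.
rewrite mulr_gt0 ?ltr0n // exprn_gt0 // divr_gt0 //.
  by rewrite subr_gt0 ltr_nat.
by rewrite subr_gt0 (ltr_nat R 1).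
Qed.

Lemma symmetric_meet A b : (0 < k)%N -> rho = k%:R ->
  A \in B -> b \in B -> b != A ->
  #|A :&: b|%:R = k%:R * (k%:R - 1) / (#|T|%:R - 1) :> R.
Proof.
move=> k0 rk AB bB bA; have := sum_meet_others k0 AB.
rewrite rk subrr !mul0r => /eqP; rewrite psumr_eq0 => [/allP|i _]; last first.
  exact: sqr_ge0.
move=> /(_ b); rewrite mem_index_enum bB bA /= => /(_ isT).
by rewrite sqrf_eq0 subr_eq0 => /eqP.
Qed.
End Fisher.

(** * Covering numbers of small sets and falling factorials *)

Definition cover_number (R : realFieldType) (T : finType) (B : {set {set T}})
  (Z : {set T}) : R := \sum_(b in B) (Z \subset b)%:R.

Lemma cover1 (R : realFieldType) (T : finType) (B : {set {set T}}) p :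
  cover_number R B [set p] = deg1 R B p.
Proof. by apply: eq_bigr => b _; rewrite sub1set. Qed.

Lemma cover2 (R : realFieldType) (T : finType) (B : {set {set T}}) p q :
  cover_number R B [set p; q] = deg2 R B p q.
Proof.
by apply: eq_bigr => b _; rewrite subUset !sub1set /inc -natrM mulnb.
Qed.

Lemma cover3 (R : realFieldType) (T : finType) (B : {set {set T}}) p q s :
  cover_number R B [set p; q; s] = deg3 R B p q s.
Proof.
by apply: eq_bigr => b _; rewrite !subUset !sub1set /inc -!natrM !mulnb.
Qed.

Lemma cards3 (T : finType) (p q s : T) :
  p != q -> q != s -> p != s -> #|[set p; q; s]| = 3%N.
Proof.
move=> pq qs ps.
by rewrite setUC cardsU1 cards2 !inE pq !(eq_sym s) negb_or ps qs.
Qed.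

Lemma ffact2R (R : realFieldType) (r : nat) :
  (r ^_ 2)%:R = r%:R * (r%:R - 1) :> R.
Proof.
by case: r => [|r]; rewrite ?mul0r // ffactnS ffactn1 natrM -natr1 addrK.
Qed.

(** The subtractions are in [R], yet small [r] is no exception: for [r < 3] one factor vanishes. *)
Lemma ffact3R (R : realFieldType) (r : nat) :
  (r ^_ 3)%:R = r%:R * (r%:R - 1) * (r%:R - 2) :> R.
Proof.
case: r => [|r]; rewrite ?mul0r // ffactnS natrM /= ffact2R -natr1; ring.
Qed.

(** * From the covering condition to complementary symmetric designs *)

Section ComplementInSecondShell.
Context (R : realFieldType) (T : finType) (B1 B2 : {set {set T}}) (u : nat).
Context (u1 : (1 <= u)%N) (cardT : #|T| = (4 * u - 1)%N).
Context (size1 : forall b, b \in B1 -> #|b| = (2 * u - 1)%N).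
Context (size2 : forall b, b \in B2 -> #|b| = (2 * u)%N).
Context (card1 : #|B1| = #|T|) (card2 : #|B2| = #|T|).
Context (h11 : forall p, deg1 R B1 p = 2 * u%:R - 1).
Context (h12 : forall p, deg1 R B2 p = 2 * u%:R).
Context (h21 : forall p q, p != q -> deg2 R B1 p q = u%:R - 1).
Context (h22 : forall p q, p != q -> deg2 R B2 p q = u%:R).
Context (h3 : forall p q s, p != q -> q != s -> p != s ->
  deg3 R B1 p q s + deg3 R B2 p q s = u%:R - 1).

Let cardTR : #|T|%:R = 4 * u%:R - 1 :> R.
Proof. by rewrite cardT natrB ?natrM // muln_gt0. Qed.

Let sizeR : (2 * u - 1)%:R = 2 * u%:R - 1 :> R.
Proof. by rewrite natrB ?natrM // muln_gt0. Qed.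

Let uR : 1 <= u%:R :> R.
Proof. by rewrite (ler_nat R 1). Qed.

Lemma disjoint_shells : [disjoint B1 & B2].
Proof.
apply/pred0P => b /=; apply/negP => /andP[/size1 + /size2].
by move=> ->; lia.
Qed.

Lemma sum_shells (F : {set T} -> R) :
  \sum_(b in B1 :|: B2) F b = \sum_(b in B1) F b + \sum_(b in B2) F b.
Proof.
rewrite -bigU ?disjoint_shells //=.
by apply: eq_bigl => b; rewrite !inE.
Qed.

(** Equality case of Fisher's inequality: [(2u - 1)(2u - 2) / (4u - 2) = u - 1]. *)
Lemma meet_first x b : x \in B1 -> b \in B1 -> b != x ->
  #|x :&: b|%:R = u%:R - 1 :> R.
Proof.
move=> xB bB bx; have k0 : (0 < 2 * u - 1)%N by lia.
have n1 : (1 < #|T|)%N by rewrite cardT; lia.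
have cB : #|B1|%:R * (2 * u - 1)%:R = #|T|%:R * (2 * u%:R - 1) :> R.
  by rewrite card1 sizeR.
have e : (2 * u%:R - 1) * ((2 * u - 1)%:R - 1)
    = (u%:R - 1) * (#|T|%:R - 1) :> R by rewrite sizeR cardTR; ring.
rewrite (symmetric_meet size1 n1 cB e h11 h21 k0 _ xB bB bx) ?sizeR ?cardTR //.
have nz : 4 * u%:R - 1 - 1 != 0 :> R by have := uR => ?; apply: lt0r_neq0; lra.
by apply: (mulIf nz); rewrite mulfVK //; ring.
Qed.

(* The sum of [m * (m - u) ^+ 2] needs the third moment over [B2], which is the
   total one minus that over [B1], known from [meet_first]. *)
Lemma meet_second x b : x \in B1 -> b \in B2 ->
  #|x :&: b| = 0%N \/ #|x :&: b| = u.
Proof.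
move=> xB bB.
(* In [B1 :|: B2] points, pairs and triples have degrees [4u - 1], [2u - 1] and [u - 1], which gives
   the total third moment. From it are subtracted the block [x] itself and the [4u - 2] other blocks
   of [B1], each meeting [x] in [u - 1] points. *)
have third : \sum_(b in B2) #|x :&: b|%:R ^+ 3
    = (u%:R - 1) * (2 * u%:R - 1) ^+ 3 + 3 * u%:R * (2 * u%:R - 1) ^+ 2
      + (4 * u%:R - 1 - 3 * (2 * u%:R - 1) + 2 * (u%:R - 1)) * (2 * u%:R - 1)
      - (2 * u%:R - 1) ^+ 3 - (4 * u%:R - 2) * (u%:R - 1) ^+ 3 :> R.
  have := @moment3 R T x (B1 :|: B2) (4 * u%:R - 1) (2 * u%:R - 1) (u%:R - 1).
  rewrite sum_shells (bigD1 x) //= setIid size1 // sizeR.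
  rewrite (eq_bigr (fun=> (u%:R - 1) ^+ 3)) => [|i /andP[iB ix]]; last first.
    by rewrite meet_first.
  rewrite (eq_bigl (mem (B1 :\ x))) => [|i]; last by rewrite !inE andbC.
  have -> : \sum_(i in mem (B1 :\ x)) (u%:R - 1) ^+ 3
      = (u%:R - 1) ^+ 3 * (4 * u%:R - 2) :> R.
    rewrite sum_const; have := cardsD1 x B1.
    rewrite xB card1 => /(congr1 (fun n => n%:R : R)).
    by rewrite cardTR natrD /= => e; congr (_ * _); lra.
  move=> /(_ _ _ _)/(canRL (addKr _))->; first ring.
  - by move=> p; rewrite /deg1 sum_shells [X in X + _]h11 [X in _ + X]h12; ring.
  - move=> p q pq.
    by rewrite /deg2 sum_shells [X in X + _]h21 // [X in _ + X]h22 //; ring.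
  - by move=> p q s pq qs ps; rewrite /deg3 sum_shells; exact: h3.
have : \sum_(b in B2) #|x :&: b|%:R * (#|x :&: b|%:R - u%:R) ^+ 2 = 0 :> R.
  rewrite (eq_bigr (fun b : {set T} => #|x :&: b|%:R ^+ 3
    + (- (2 * u%:R)) * #|x :&: b|%:R ^+ 2 + u%:R ^+ 2 * #|x :&: b|%:R))
    => [|i _].
    rewrite !big_split /= -!mulr_sumr third (moment1 _ h12) (moment2 _ h12 h22).
    by rewrite size1 // sizeR; ring.
  by ring.
move/eqP; rewrite psumr_eq0 => [/allP /(_ b)|i _]; last first.
  by rewrite mulr_ge0 ?sqr_ge0.
rewrite mem_index_enum bB /= => /(_ isT).
rewrite mulf_eq0 sqrf_eq0 subr_eq0 pnatr_eq0 eqr_nat.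
by case/orP => /eqP; [left|right].
Qed.

Lemma complement_second x : x \in B1 -> ~: x \in B2.
Proof.
move=> xB; have [/existsP[b /andP[bB /eqP bx]]|] :=
  boolP [exists b in B2, #|x :&: b| == 0%N].
  (* A block [b] disjoint from [x] lies in [~: x], and both have [2u] points. *)
  suff -> : ~: x = b by [].
  apply/esym/eqP; rewrite eqEcard; apply/andP; split.
    by rewrite -disjoints_subset disjoint_sym -setI_eq0 -cards_eq0 bx.
  by have := cardsC x; rewrite (size1 xB) (size2 bB) cardT; lia.
(* Otherwise every block of [B2] meets [x] in [u] points, and the first moment would give
   [u (4u - 1) = 2u (2u - 1)], impossible for [u >= 1]. *)
rewrite negb_exists => /forallP all_u.
have := moment1 x h12; rewrite (eq_bigr (fun=> u%:R)) => [|b bB]; last first.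
  by case: (meet_second xB bB) => [e|-> //]; have := all_u b; rewrite bB e.
rewrite sum_const card2 cardTR size1 // sizeR => h.
by have := uR; lra.
Qed.

End ComplementInSecondShell.

(** [deg_split] makes the degrees of each block set constant. Fisher's inequality then gives at
    least [#|T|] blocks in each, so the total [2 * #|T|] forces equality in both. *)
Lemma tight_cover_symmetric (R : realFieldType) (T : finType)
    (B1 B2 : {set {set T}}) (u : nat) : (1 <= u)%N -> #|T| = (4 * u - 1)%N ->
  (forall b, b \in B1 -> #|b| = (2 * u - 1)%N) ->
  (forall b, b \in B2 -> #|b| = (2 * u)%N) ->
  B1 != set0 -> B2 != set0 -> (#|B1| + #|B2| = 2 * #|T|)%N ->
  (forall Z : {set T}, (1 <= #|Z| <= 3)%N ->
     cover_number R B1 Z + cover_number R B2 Z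
     = #|B1|%:R * ((2 * u - 1) ^_ #|Z|)%:R / (#|T| ^_ #|Z|)%:R
       + #|B2|%:R * ((2 * u) ^_ #|Z|)%:R / (#|T| ^_ #|Z|)%:R) ->
  [/\ #|B1| = #|T|, forall p q, p != q -> deg2 R B1 p q = u%:R - 1
    & B2 = [set ~: b | b in B1]].
Proof.
move=> u1 cT s1 s2 B1n0 B2n0 cB H.
set x := #|B1|%:R : R; set y := #|B2|%:R : R.
pose U : R := u%:R; have U1 : 1 <= U by rewrite (ler_nat R 1).
have nR : #|T|%:R = 4 * U - 1 by rewrite cT natrB ?natrM // muln_gt0.
have r1R : (2 * u - 1)%:R = 2 * U - 1 by rewrite natrB ?natrM // muln_gt0.
have r2R : (2 * u)%:R = 2 * U by rewrite natrM.
have nz1 : 4 * U - 1 != 0 by apply: lt0r_neq0; lra.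
have nz2 : 4 * U - 1 - 1 != 0 by apply: lt0r_neq0; lra.
have nz3 : 4 * U - 1 - 2 != 0 by apply: lt0r_neq0; lra.
(* These are the point, pair and triple degrees that a 3-design with [m] blocks of size [r] would
   have. *)
pose rho (m r : R) := m * r / (4 * U - 1).
pose lam (m r : R) := rho m r * (r - 1) / (4 * U - 1 - 1).
pose mu (m r : R) := lam m r * (r - 2) / (4 * U - 1 - 2).
have h1 p : deg1 R B1 p + deg1 R B2 p = rho x (2 * U - 1) + rho y (2 * U).
  by have := H [set p]; rewrite !cover1 cards1 !ffactn1 nR r1R r2R; apply.
have h2 p q : p != q -> deg2 R B1 p q + deg2 R B2 p q
    = lam x (2 * U - 1) + lam y (2 * U).
  move=> pq; have := H [set p; q].
  rewrite !cover2 cards2 pq !ffact2R nR r1R r2R => -> //.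
  by rewrite /lam /rho -/x -/y; field; rewrite nz1 nz2.
have h3 p q s : p != q -> q != s -> p != s ->
    deg3 R B1 p q s + deg3 R B2 p q s = mu x (2 * U - 1) + mu y (2 * U).
  move=> pq qs ps; have := H [set p; q; s].
  rewrite !cover3 cards3 // !ffact3R nR r1R r2R => -> //.
  by rewrite /mu /lam /rho -/x -/y; field; rewrite nz1 nz2 nz3.
have lamE m r : rho m r * (r - 1) = lam m r * (#|T|%:R - 1).
  by rewrite nR mulfVK.
have muE m r : lam m r * (r - 2) = mu m r * (#|T|%:R - 2).
  by rewrite nR mulfVK.
have [h11 h21] : (forall p, deg1 R B1 p = rho x (2 * U - 1)) /\
    (forall p q, p != q -> deg2 R B1 p q = lam x (2 * U - 1)).
  apply: (@deg_split R T B1 B2 (2 * u - 1) (2 * u) _ (rho y (2 * U)) _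
    (lam y (2 * U)) (mu x (2 * U - 1)) (mu y (2 * U))); rewrite ?r1R ?r2R //.
  by lia.
have h12 p : deg1 R B2 p = rho y (2 * U).
  by have := h1 p; rewrite h11 => /addrI.
have h22 p q : p != q -> deg2 R B2 p q = lam y (2 * U).
  by move=> pq; have := h2 _ _ pq; rewrite h21 // => /addrI.
have n1 : (1 < #|T|)%N by rewrite cT; lia.
have rhoE m r : m * r = #|T|%:R * rho m r by rewrite nR [RHS]mulrC mulfVK.
(* Since [rho = m k / n], the bound [k <= rho] amounts to [n <= m]. *)
have fisher_bound m k : (0 < k)%N -> k%:R <= rho m%:R k%:R -> (#|T| <= m)%N.
  move=> k0; rewrite -(@ler_nat R) /rho -nR ler_pdivlMr ?ltr0n; last by lia.
  by rewrite mulrC ler_pM2r ?ltr0n.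
have le1 : (#|T| <= #|B1|)%N.
  apply: (fisher_bound _ (2 * u - 1)%N); first by lia.
  rewrite r1R -/x -r1R.
  apply: (fisher s1 n1 _ _ _ h21) => //; rewrite ?r1R //.
  by rewrite cT; lia.
have le2 : (#|T| <= #|B2|)%N.
  apply: (fisher_bound _ (2 * u)%N); first by lia.
  rewrite r2R -/y -r2R.
  apply: (fisher s2 n1 _ _ _ h22) => //; rewrite ?r2R //.
  by rewrite cT; lia.
have c1 : #|B1| = #|T| by lia.
have c2 : #|B2| = #|T| by lia.
have rhoT r : rho (4 * U - 1) r = r by rewrite /rho mulrAC mulfV ?mul1r.
have xE : x = 4 * U - 1 by rewrite /x c1.
have yE : y = 4 * U - 1 by rewrite /y c2.
have lam1 : lam x (2 * U - 1) = U - 1.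
  by rewrite xE /lam rhoT; apply: (mulIf nz2); rewrite mulfVK //; ring.
have lam2 : lam y (2 * U) = U.
  by rewrite yE /lam rhoT; apply: (mulIf nz2); rewrite mulfVK //; ring.
have mu12 : mu x (2 * U - 1) + mu y (2 * U) = U - 1.
  rewrite /mu lam1 lam2; apply: (mulIf nz3).
  by rewrite mulrDl !mulfVK //; ring.
have h21' p q : p != q -> deg2 R B1 p q = U - 1 by rewrite -lam1; exact: h21.
(* Complementation is injective and the two block sets are equally large, so the inclusion of the
   complements in [B2] suffices. *)
split=> //; apply/esym/eqP; rewrite eqEcard card_imset; last exact: setC_inj.
rewrite c1 c2 leqnn andbT; apply/subsetP => _ /imsetP[b bB ->].
apply: (@complement_second R T B1 B2 u) => //.
- by move=> p; rewrite h11 xE rhoT.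
- by move=> p; rewrite h12 yE rhoT.
- by rewrite -/U -lam2.
- by rewrite -/U -mu12.
Qed.

(** * From complementary symmetric designs to the covering condition *)

Lemma cards3P (T : finType) (Z : {set T}) : #|Z| = 3%N ->
  exists p q s, [/\ p != q, q != s, p != s & Z = [set p; q; s]].
Proof.
move=> cZ; have /card_gt0P[p pZ] : (0 < #|Z|)%N by rewrite cZ.
have := cardsD1 p Z; rewrite cZ pZ add1n => -[/esym/eqP/cards2P[q [s [qs e]]]].
have pqs : p \notin [set q; s] by rewrite -e !inE eqxx.
move: pqs; rewrite !inE negb_or => /andP[pq ps].
by exists p, q, s; split=> //; rewrite -(setD1K pZ) e setUA.
Qed.

Section ComplementaryPair.
Context (R : realFieldType) (T : finType) (B : {set {set T}}) (u : nat).
Context (u1 : (1 <= u)%N) (cardT : #|T| = (4 * u - 1)%N).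
Context (sizeB : forall b, b \in B -> #|b| = (2 * u - 1)%N).
Context (cardB : #|B| = #|T|).
Context (h2 : forall p q, p != q -> deg2 R B p q = u%:R - 1).

(** Counting pairs through [p] gives [(2u - 2) deg1 = (u - 1)(4u - 2)], which determines the degree
    only for [u > 1]. *)
Lemma symmetric_deg1 p : deg1 R B p = 2 * u%:R - 1.
Proof.
have [u2|] := ltnP 1 u; last first.
  move=> u_le1; have u_eq : u = 1%N by lia.
  (* For [u = 1] the blocks are three singletons in a set of three points, hence all the
     singletons. *)
  have -> : B = [set [set q] | q in [set: T]].
    apply/eqP; rewrite eqEcard card_imset; last exact: set1_inj.
    rewrite cardsT cardB leqnn andbT; apply/subsetP => b /sizeB.
    rewrite u_eq => /eqP/cards1P[q ->]; exact: imset_f.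
  rewrite /deg1 big_imset /=; last by move=> ? ? _ _; exact: set1_inj.
  rewrite (eq_bigr (fun q => (p == q)%:R * 1)) => [|q _]; last first.
    by rewrite /inc inE mulr1.
  by rewrite sum_pred1 inE u_eq /=; ring.
have := sum_deg2 R p sizeB.
have U1 : 1 < u%:R :> R by rewrite (ltr_nat R 1).
rewrite (eq_bigr (fun q => (u%:R - 1)
    + (p == q)%:R * (deg1 R B p - (u%:R - 1)))) => [|q _]; last first.
  by case: eqVneq => [<-|/h2->]; rewrite /= ?deg2xx; ring.
rewrite (eq_bigl [in [set: T]]) => [|q]; last by rewrite inE.
rewrite big_split /= sum_const sum_pred1 cardsT inE /= cardT.
rewrite !natrB ?muln_gt0 //.
rewrite !natrM => h; have nz : 2 * (u%:R - 1) != 0 :> R.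
  by apply: lt0r_neq0; lra.
by apply: (mulfI nz); lra.
Qed.

Lemma sum_compl (F : {set T} -> R) :
  \sum_(b in [set ~: b | b in B]) F b = \sum_(b in B) F (~: b).
Proof. by rewrite big_imset //= => ? ? _ _; exact: setC_inj. Qed.

(** For a triple, inclusion-exclusion on the complements produces the triple degree of [B] with sign
    [-1], cancelling the one from [B]. Only point and pair degrees remain, so no regularity of [B]
    on triples is required. *)
Lemma complementary_cover (Z : {set T}) : (1 <= #|Z| <= 3)%N ->
  cover_number R B Z + cover_number R [set ~: b | b in B] Z
  = #|T|%:R * ((2 * u - 1) ^_ #|Z|)%:R / (#|T| ^_ #|Z|)%:R
    + #|T|%:R * ((2 * u) ^_ #|Z|)%:R / (#|T| ^_ #|Z|)%:R.
Proof.
pose U : R := u%:R; have U1 : 1 <= U by rewrite (ler_nat R 1).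
have nR : #|T|%:R = 4 * U - 1 by rewrite cardT natrB ?natrM // muln_gt0.
have r1R : (2 * u - 1)%:R = 2 * U - 1 by rewrite natrB ?natrM // muln_gt0.
have r2R : (2 * u)%:R = 2 * U by rewrite natrM.
have nz1 : 4 * U - 1 != 0 by apply: lt0r_neq0; lra.
have nz2 : 4 * U - 1 - 1 != 0 by apply: lt0r_neq0; lra.
have nz3 : 4 * U - 1 - 2 != 0 by apply: lt0r_neq0; lra.
have c1 : \sum_(b in B) 1 = 4 * U - 1 by rewrite sum_const mul1r cardB.
move=> /andP[Z1 Z3]; have [e|[e|e]] : #|Z| = 1%N \/ #|Z| = 2%N \/ #|Z| = 3%N.
- by move: #|Z| Z1 Z3 => [|[|[|[|]]]] // _ _; [left|right; left|right; right].
- rewrite e !ffactn1 nR r1R r2R.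
  have /eqP/cards1P[p ->] := e; rewrite !cover1 /deg1 sum_compl -big_split /=.
  rewrite (eq_bigr (fun=> 1)) => [|b _]; last by rewrite incC; ring.
  by rewrite c1; field.
- rewrite e !ffact2R nR r1R r2R.
  have /eqP/cards2P[p [q [pq ->]]] := e.
  rewrite !cover2 {2}/deg2 sum_compl h2 //.
  rewrite (eq_bigr (fun b => 1 - inc R b p - inc R b q
    + inc R b p * inc R b q)) => [|b _]; last by rewrite !incC; ring.
  rewrite big_split !sumrB /= c1 -/(deg1 R B p) -/(deg1 R B q).
  rewrite -/(deg2 R B p q) h2 // !symmetric_deg1 -/U.
  by field; rewrite nz1 nz2.
rewrite e !ffact3R nR r1R r2R.
have [p [q [s [pq qs ps ->]]]] := cards3P e.
rewrite !cover3 {2}/deg3 sum_compl -big_split /=.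
rewrite (eq_bigr (fun b => 1 - inc R b p - inc R b q - inc R b s
    + inc R b p * inc R b q + inc R b q * inc R b s + inc R b p * inc R b s))
  => [|b _]; last by rewrite !incC; ring.
rewrite 3!big_split !sumrB /= c1.
rewrite -/(deg1 R B p) -/(deg1 R B q) -/(deg1 R B s).
rewrite -/(deg2 R B p q) -/(deg2 R B q s) -/(deg2 R B p s) !h2 //.
rewrite !symmetric_deg1 -/U.
by field; rewrite nz1 nz2 nz3.
Qed.
End ComplementaryPair.

(** * Translation from points of the Hamming scheme to blocks *)

Lemma supp_inj (n : nat) : injective (@supp n).
Proof.
by move=> x y /setP e; apply/ffunP => i; have := e i; rewrite !inE.
Qed.

Lemma supp_ffun (n : nat) (Z : {set 'I_n}) :
  supp [ffun i => i \in Z] = Z.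
Proof. by apply/setP => i; rewrite inE ffunE. Qed.

(** The lower index [n - r] keeps the identity valid for [j > r], where both sides vanish; with
    [r - j], truncation to [0] would give a binomial equal to [1]. This case occurs: for [u = 1] the
    first shell has [r = 1] while [j] goes up to [3]. *)
Lemma bin_sub_ffact (n r j : nat) : (r <= n)%N ->
  ('C(n - j, n - r) * n ^_ j = r ^_ j * 'C(n, n - r))%N.
Proof.
move=> rn; elim: j => [|j IH]; first by rewrite subn0 !ffactn0 muln1 mul1n.
rewrite !ffactnSr subnS mulnC -mulnA mul_bin_down.
have -> : (n - j - (n - r) = r - j)%N by lia.
by rewrite mulnCA [(n ^_ j * _)%N]mulnC IH mulnCA mulnA.
Qed.

(** Taking complements turns the [r]-sets containing [Z] into the [(n - r)]-subsets of [~: Z]. *)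
Lemma card_shell_above (n r : nat) (Z : {set 'I_n}) : (r <= n)%N ->
  #|[set x in shell n r | Z \subset supp x]| = 'C(n - #|Z|, n - r).
Proof.
move=> rn; have cC (A : {set 'I_n}) : #|~: A| = (n - #|A|)%N.
  by rewrite cardsCs setCK card_ord.
rewrite -cC -cards_draws.
rewrite -(card_imset _ (inj_comp (@setC_inj 'I_n) (@supp_inj n))).
apply: eq_card => A; rewrite [RHS]inE; apply/imsetP/andP => [[x]|[AZ /eqP cA]].
  by rewrite !inE => /andP[/eqP cx Zx] ->; rewrite /= setCS cC cx eqxx.
exists [ffun i => i \in ~: A]; last by rewrite /= supp_ffun setCK.
rewrite !inE supp_ffun cC cA subKn // eqxx /=.
by rewrite -setCS setCK.
Qed.

(** The weight of the part is its number of blocks, and the average of [supp_ind R z] over the shell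
    is a ratio of binomials that [bin_sub_ffact] turns into falling factorials. *)
Lemma shell_termE (R : realType) (n r : nat) (Y : {set point n})
    (w : point n -> R) (z : point n) :
  (r <= n)%N -> (forall y, y \in Y -> w y = 1) ->
  shell_term Y w z r
  = #|blocks r Y|%:R * (r ^_ #|supp z|)%:R / (n ^_ #|supp z|)%:R.
Proof.
move=> rn hw; rewrite /shell_term /weight.
rewrite (eq_bigr (fun=> 1)) => [|y /setIP[/hw->//]].
rewrite sum_const mul1r /blocks card_imset; last exact: supp_inj.
have -> : \sum_(x in shell n r) supp_ind R z x = 'C(n - #|supp z|, n - r)%:R.
  rewrite -card_shell_above // -sum1_card natr_sum big_mkcond [RHS]big_mkcond.
  apply: eq_bigr => x _; rewrite /supp_ind !inE.
  by case: (_ == r); case: (_ \subset _).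
have -> : #|shell n r| = 'C(n, n - r).
  have := card_shell_above set0 rn; rewrite cards0 subn0 => <-.
  by apply: eq_card => x; rewrite !inE sub0set andbT.
have cz : (#|supp z| <= n)%N by rewrite -[X in (_ <= X)%N]card_ord max_card.
have nz1 : 'C(n, n - r)%:R != 0 :> R.
  by rewrite pnatr_eq0 -lt0n bin_gt0 leq_subr.
have nz2 : (n ^_ #|supp z|)%:R != 0 :> R by rewrite pnatr_eq0 -lt0n ffact_gt0.
apply: (mulIf nz2); rewrite mulfVK // -[LHS]mulrA.
rewrite -[X in _ * X = _]natrM bin_sub_ffact // natrM.
by field.
Qed.

Lemma blocks_size (n r : nat) (Y : {set point n}) b :
  b \in blocks r Y -> #|b| = r.
Proof. by move=> /imsetP[y]; rewrite !inE => /andP[_ /eqP<-] ->. Qed.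

Lemma sum_two_shells (R : realType) (n r1 r2 : nat) (Y : {set point n})
    (F : point n -> R) : r1 != r2 -> Y \subset shell n r1 :|: shell n r2 ->
  \sum_(y in Y) F y
  = \sum_(y in shell_part r1 Y) F y + \sum_(y in shell_part r2 Y) F y.
Proof.
move=> r12 /subsetP hY; rewrite -bigU /=.
  apply: eq_bigl => y; rewrite !inE -andb_orr.
  by apply/idP/andP => [yY|[]//]; have := hY y yY; rewrite !inE.
apply/pred0P => y /=; rewrite !inE; case: eqVneq => [->|_]; rewrite ?andbF //.
by rewrite (negbTE r12) !andbF.
Qed.

Lemma cover_blocks (R : realType) (n r : nat) (Y : {set point n}) z :
  \sum_(y in shell_part r Y) supp_ind R z y
  = cover_number R (blocks r Y) (supp z).
Proof. by rewrite /cover_number big_imset //= => ? ? _ _; exact: supp_inj. Qed.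

(** Every set [Z] is the support of a point, so the design condition for [j = 1, 2, 3] becomes one
    on covering numbers, free of weights. *)
Lemma tight_cover (R : realType) (n r1 r2 : nat) (Y : {set point n})
    (w : point n -> R) : r1 != r2 -> (r1 <= n)%N -> (r2 <= n)%N ->
  Y \subset shell n r1 :|: shell n r2 -> (forall y, y \in Y -> w y = 1) ->
  tight_relative_design 1 r1 r2 Y w <->
  [/\ blocks r1 Y != set0, blocks r2 Y != set0,
      (#|blocks r1 Y| + #|blocks r2 Y| = 2 * n)%N
    & forall Z : {set 'I_n}, (1 <= #|Z| <= 3)%N ->
      cover_number R (blocks r1 Y) Z + cover_number R (blocks r2 Y) Z
      = #|blocks r1 Y|%:R * (r1 ^_ #|Z|)%:R / (n ^_ #|Z|)%:R
        + #|blocks r2 Y|%:R * (r2 ^_ #|Z|)%:R / (n ^_ #|Z|)%:R].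
Proof.
move=> r12 r1n r2n hY hw.
have cardY : #|Y| = (#|blocks r1 Y| + #|blocks r2 Y|)%N.
  apply/eqP; rewrite -(@eqr_nat R) natrD.
  rewrite !card_imset; try exact: supp_inj.
  by rewrite -!sum1_card !natr_sum (sum_two_shells _ r12 hY).
have sumY z : \sum_(y in Y) w y * supp_ind R z y
    = cover_number R (blocks r1 Y) (supp z)
      + cover_number R (blocks r2 Y) (supp z).
  rewrite -!cover_blocks -(sum_two_shells _ r12 hY).
  by apply: eq_bigr => y /hw->; rewrite mul1r.
split=> [[[_ _ _ H] [ne1 ne2] _ cY]|[ne1 ne2 cY H]].
  rewrite !imset_eq0; split=> //; first by rewrite -cardY cY bin1.
  move=> Z cZ; have := H #|Z| [ffun i => i \in Z] cZ.
  rewrite inE supp_ffun eqxx => /(_ isT).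
  by rewrite !shell_termE // sumY supp_ffun => <-.
split; last by rewrite cardY cY bin1.
- split=> //; [exact/eqP|by move=> y /hw->|move=> j z jt].
  rewrite inE => /eqP zj; rewrite !shell_termE // sumY H // zj //.
- by move: ne1 ne2; rewrite !imset_eq0.
- by split=> x y /setIP[xY _] /setIP[yY _]; rewrite !hw.
Qed.

Lemma pair_count (R : realFieldType) (T : finType) (B : {set {set T}}) p q :
  deg2 R B p q = #|[set b in B | (p \in b) && (q \in b)]|%:R.
Proof.
rewrite -sum1_card natr_sum /deg2 big_mkcond [RHS]big_mkcond /=.
apply: eq_bigr => b _; rewrite !inE /inc -natrM mulnb.
by case: (b \in B) => //=; case: (_ && _).
Qed.

Theorem theorem3p6 (R : realType) (u n r1 r2 : nat)
  (hu : (1 <= u)%N) (hn : n = (4 * u - 1)%N)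
  (hr1 : r1 = (2 * u - 1)%N) (hr2 : r2 = (2 * u)%N)
  (Y : {set point n}) (w : point n -> R)
  (hY : Y \subset shell n r1 :|: shell n r2)
  (hw : forall y, y \in Y -> w y = 1) :
  tight_relative_design 1 r1 r2 Y w <->
  (symmetric_two_design (2 * u - 1) (u - 1) (blocks r1 Y) /\
   blocks r2 Y = complementary (blocks r1 Y)).
Proof.
have r12 : r1 != r2 by lia.
have r1n : (r1 <= n)%N by lia.
have r2n : (r2 <= n)%N by lia.
have cT : #|'I_n| = (4 * u - 1)%N by rewrite card_ord.
have size1 b : b \in blocks r1 Y -> #|b| = (2 * u - 1)%N.
  by rewrite -hr1; exact: blocks_size.
have size2 b : b \in blocks r2 Y -> #|b| = (2 * u)%N.
  by rewrite -hr2; exact: blocks_size.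
have uR : (u - 1)%:R = u%:R - 1 :> R by rewrite natrB.
rewrite tight_cover //; split=> [[ne1 ne2 cY H]|[[[_ pairs] cB1] compl]].
  have [] := tight_cover_symmetric (R := R) hu cT size1 size2 ne1 ne2.
  - by rewrite card_ord.
  - by move=> Z cZ; rewrite card_ord -hr1 -hr2 H.
  rewrite card_ord => cB1 pairs compl; do 3!split=> //.
  move=> p q pq; apply/eqP; rewrite -(eqr_nat R) -pair_count pairs //.
  by rewrite uR.
have cB2 : #|blocks r2 Y| = n.
  by rewrite compl card_imset //; exact: setC_inj.
(* Each block set has [n] members, so [n > 0] makes both shells meet [Y]. *)
have n0 : (0 < n)%N by lia.
split; rewrite -?card_gt0 ?cB1 ?cB2 //; first by lia.
move=> Z cZ; rewrite compl.
have := @complementary_cover R _ (blocks r1 Y) u hu cT size1 _ _ Z cZ.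
rewrite card_ord hr1 hr2; apply=> [|p q pq].
  by rewrite -hr1 cB1.
by rewrite pair_count -hr1 pairs // uR.
Qed.
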